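(* There exist a ($T_1$) topological space $X$ and a point $x\in X$ such that player Two has a winning strategy in the game $\mathsf{G}_{\mathrm{fin}}(\Omega_x,\Omega_x)$ on $X$, but for every unbounded function $f:\omega\to\mathbb{N}$ the property $\mathsf{S}_f(\Omega_x,\Omega_x)$ fails in $X$.
   Context: All topological spaces are assumed to be $T_1$; $\mathbb{N}=\omega\setminus\{0\}$. For a space $X$ and $x\in X$, let $\Omega_x=\{A\subseteq X: x\in\overline{A}\}$. For $f:\omega\to\mathbb{N}$, $\mathsf{S}_f(\Omega_x,\Omega_x)$ is the statement: for every sequence $(A_n)_{n\in\omega}$ of elements of $\Omega_x$ there are sets $F_n\subseteq A_n$ with $|F_n|\le f(n)$ for each $n\in\omega$ and $\bigcup_{n\in\omega}F_n\in\Omega_x$. The game $\mathsf{G}_{\mathrm{fin}}(\Omega_x,\Omega_x)$ on $X$ is played by One and Two: in each inning $n\in\omega$, One chooses $A_n\in\Omega_x$, and then Two chooses a finite subset $F_n\subseteq A_n$. Two wins if $\bigcup_{n\in\omega}F_n\in\Omega_x$; otherwise One wins. *)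

(* Defs.v *)
From mathcomp Require Import all_boot all_classical.
From mathcomp Require Import topology_structure separation_axioms.

Set Implicit Arguments.
Unset Strict Implicit.
Unset Printing Implicit Defensive.

Local Open Scope classical_set_scope.
Local Open Scope card_scope.

Definition Omega (X : topologicalType) (x : X) : set (set X) :=
  [set A | closure A x].

Definition S_f (X : topologicalType) (x : X) (f : nat -> nat) : Prop :=
  forall A : nat -> set X, (forall n, Omega x (A n)) ->
  exists F : nat -> set X,
    [/\ forall n, F n `<=` A n,
        forall n, F n #<= `I_(f n) &
        Omega x (\bigcup_n F n)].

(* A strategy for Two maps the nonempty history [:: A_0; ...; A_n] of One's
   moves to Two's answer F_n; Two's own earlier moves are determined by it. *)
Definition strategy_Two (X : topologicalType) := seq (set X) -> set X.

Definition reply (X : topologicalType) (s : strategy_Two X)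
  (A : nat -> set X) (n : nat) : set X := s (mkseq A n.+1).

(* The first conjunct says that the answers prescribed by s are legal moves.
   Every finite sequence of elements of Omega x extends to an infinite one, so
   this covers every position reachable by legal moves of One. *)
Definition winning_Gfin (X : topologicalType) (x : X) (s : strategy_Two X) :
    Prop :=
  forall A : nat -> set X, (forall n, Omega x (A n)) ->
    (forall n, finite_set (reply s A n) /\ reply s A n `<=` A n) /\
    Omega x (\bigcup_n reply s A n).

Definition Two_wins_Gfin (X : topologicalType) (x : X) : Prop :=
  exists s : strategy_Two X, winning_Gfin x s.

Definition unbounded (f : nat -> nat) : Prop := forall m, exists n, m < f n.

(* Main.v *)
Require Import Defs.
From HB Require Import structures.
From mathcomp Require Import all_boot all_classical.
From mathcomp Require Import topology_structure separation_axioms.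

(** On nat * nat consider the ideal of the sets whose m-th column has at most
    c * (m + 1) points, for some constant c, and let x be a point at infinity
    whose punctured neighborhoods are the complements of the members of the
    ideal, all other points being isolated.  That a set is not in the ideal with
    constant c is witnessed by finitely many of its points in one column, so Two
    wins by answering in inning n with a witness for c = n + 1.  On the other
    hand, when One plays in inning n the columns from f 0 + ... + f n on,
    selections of at most f n points leave at most m points in column m. *)

Set Implicit Arguments.
Unset Strict Implicit.
Unset Printing Implicit Defensive.

Local Open Scope classical_set_scope.
Local Open Scope card_scope.

(** This is [B] having at most [k] points, stated through a covering list, possibly with
    repetitions, so that bounds add under concatenation. *)
Definition coverable (T : eqType) (k : nat) (B : set T) : Prop :=
  exists2 s : seq T, size s <= k & B `<=` [set` s].

Lemma coverableS (T : eqType) (j k : nat) (A B : set T) :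
  j <= k -> A `<=` B -> coverable j B -> coverable k A.
Proof.
move=> jk AB [s sj Bs]; exists s; first exact: leq_trans jk.
exact: subset_trans Bs.
Qed.

Lemma coverable0 (T : eqType) (k : nat) : coverable k (@set0 T).
Proof. by exists [::]. Qed.

Lemma coverable1 (T : eqType) (x : T) : coverable 1 [set x].
Proof. by exists [:: x] => // _ -> /=; rewrite inE. Qed.

Lemma coverableU (T : eqType) (j k : nat) (A B : set T) :
  coverable j A -> coverable k B -> coverable (j + k) (A `|` B).
Proof.
move=> [s sj As] [t tk Bt]; exists (s ++ t); first by rewrite size_cat leq_add.
by move=> x [/As|/Bt] /= xs; rewrite mem_cat xs ?orbT.
Qed.

Lemma coverable_image (T U : eqType) (h : T -> U) (k : nat) (B : set T) :
  coverable k B -> coverable k (h @` B).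
Proof.
move=> [s sk Bs]; exists (map h s); first by rewrite size_map.
by move=> _ [x /Bs xs <-]; apply: map_f.
Qed.

Lemma card_le_coverable (T : pointedType) (k : nat) (B : set T) :
  B #<= `I_k -> coverable k B.
Proof.
move=> /pcard_surjP[g gB]; exists (map g (iota 0 k)).
  by rewrite size_map size_iota.
by move=> x /gB[i ik <-]; apply/map_f; rewrite mem_iota.
Qed.

(** A repetition-free list in [B] either exhausts [B] or can be lengthened by one point. The second
    alternative supplies finite witnesses against a bound. *)
Lemma coverable_or_uniq (T : eqType) (k : nat) (B : set T) :
  coverable k B \/ exists t : seq T, [/\ uniq t, size t = k.+1 & [set` t] `<=` B].
Proof.
suff [|[t [ut st tB]]] : coverable k B \/
    exists t, [/\ uniq t, size t = k.+1 & [set` t] `<=` B] by [left|right; exists t].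
elim: k => [|k [[s sk Bs]|[t [ut st tB]]]].
- have [[x Bx]|B0] := pselect (exists x, B x).
    by right; exists [:: x]; split=> // y /=; rewrite inE => /eqP ->.
  by left; exists [::] => // x Bx; case: B0; exists x.
- by left; exists s => //; apply: leqW.
have [Bt|/existsNP[x /not_implyP[Bx /negP xt]]] :=
    pselect (forall x, B x -> x \in t).
  by left; exists t; rewrite ?st.
right; exists (x :: t); split=> /=; rewrite ?ut ?st ?andbT //.
by move=> y /=; rewrite inE => /predU1P[->//|/tB].
Qed.

Lemma uniq_not_coverable (T : eqType) (k : nat) (B : set T) (t : seq T) :
  uniq t -> k < size t -> [set` t] `<=` B -> ~ coverable k B.
Proof.
move=> ut kt tB [s sk Bs]; have := uniq_leq_size ut (fun y yt => Bs y (tB y yt)).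
by rewrite leqNgt (leq_ltn_trans sk kt).
Qed.

Definition column (T : Type) (A : set (nat * T)) (m : nat) : set T :=
  [set i | A (m, i)].

Definition linear_columns (A : set (nat * nat)) : Prop :=
  exists c, forall m, coverable (c * m.+1) (column A m).

Lemma linear_columnsS (A B : set (nat * nat)) :
  A `<=` B -> linear_columns B -> linear_columns A.
Proof.
by move=> AB [c cB]; exists c => m; apply: coverableS (cB m) => // i; apply: AB.
Qed.

Lemma linear_columns0 : linear_columns set0.
Proof. by exists 0 => m; apply: coverable0. Qed.

Lemma linear_columns1 (p : nat * nat) : linear_columns [set p].
Proof.
exists 1 => m; apply: (coverableS _ _ (coverable1 p.2)) => //.
by move=> i; rewrite /column /= => <-.
Qed.

Lemma linear_columnsU (A B : set (nat * nat)) :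
  linear_columns A -> linear_columns B -> linear_columns (A `|` B).
Proof.
by move=> [c cA] [d dB]; exists (c + d) => m; rewrite mulnDl; apply: coverableU.
Qed.

Definition linear_space : Type := option (nat * nat).

HB.instance Definition _ := Choice.copy linear_space (option (nat * nat)).

Definition infty : linear_space := None.

Definition linear_open : set (set linear_space) :=
  [set U | U infty -> linear_columns (Some @^-1` ~` U)].

Lemma linear_openT : linear_open setT.
Proof.
by move=> _; rewrite setCT preimage_set0; apply: linear_columns0.
Qed.

Lemma linear_openI : setI_closed linear_open.
Proof.
move=> U V oU oV [/oU lU /oV lV].
by rewrite setCI preimage_setU; apply: linear_columnsU.
Qed.

Lemma linear_open_bigU (I : Type) (U : I -> set linear_space) :
  (forall i, linear_open (U i)) -> linear_open (\bigcup_i U i).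
Proof.
move=> oU [i _ /oU]; apply: linear_columnsS => p /= nUp Uip.
by apply: nUp; exists i.
Qed.

HB.instance Definition _ := isOpenTopological.Build linear_space
  linear_openT linear_openI linear_open_bigU.

Lemma open_linear_space (U : set linear_space) : open U = linear_open U.
Proof.
rewrite openE; apply/propext; split=> [oU /oU|oU x Ux]; last by exists U; split.
move=> [V [oV VN VU]].
by apply: linear_columnsS (oV VN) => p /=; apply/contra_not/VU.
Qed.

Lemma accessible_linear_space : accessible_space linear_space.
Proof.
move=> x y xy; exists (~` [set y]); rewrite open_linear_space; split.
- rewrite /linear_open /= setCK; case: y {xy} => [p _|//].
  by apply: linear_columnsS (linear_columns1 p) => q [->].
- by rewrite inE => /eqP; apply/negP.
- by rewrite inE setCK.
Qed.

(** If the trace of [A] is in the ideal, removing [A] except for [infty] leaves a neighborhood of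
    [infty]. Conversely, a neighborhood disjoint from [A] puts the trace inside a member of the
    ideal. *)
Lemma Omega_inftyE (A : set linear_space) :
  Omega infty A <-> A infty \/ ~ linear_columns (Some @^-1` A).
Proof.
split=> [clA|[AN|nlA]].
- have [|lA] := pselect (linear_columns (Some @^-1` A)); last by right.
  move=> lA; left; have /clA[y [Ay nAy]] : nbhs infty (~` (A `\ infty)).
    apply: open_nbhs_nbhs; split; last by case=> _; apply.
    rewrite open_linear_space /linear_open /= => _.
    by apply: linear_columnsS lA => p /= /contrapT[].
  by apply: contrapT => nAN; apply: nAy; split=> // yN; rewrite yN in Ay.
- exact: subset_closure.
move=> B; rewrite nbhsE => -[U [oU UN] UB]; apply: contrapT => AB0; apply: nlA.
move: oU; rewrite open_linear_space => /(_ UN); apply: linear_columnsS.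
by move=> p /= Ap Up; apply: AB0; exists (Some p); split=> //; apply: UB.
Qed.

Lemma finite_witness (A : set linear_space) (c : nat) : Omega infty A ->
  exists F : set linear_space, [/\ finite_set F, F `<=` A &
    F infty \/ exists m, ~ coverable (c * m.+1) (column (Some @^-1` F) m)].
Proof.
move=> /Omega_inftyE[AN|nlA].
  by exists [set infty]; split; [exact: finite_set1|move=> _ ->|left].
have /existsNP[m ncA] : ~ forall m, coverable (c * m.+1) (column (Some @^-1` A) m).
  by move=> cA; apply: nlA; exists c.
have [//|[t [ut st tA]]] :=
  coverable_or_uniq (c * m.+1) (column (Some @^-1` A) m).
exists [set Some (m, i) | i in [set` t]]; split.
- exact/finite_image/finite_seq.
- by move=> _ [i it <-]; apply: tA.
- right; exists m; apply: (uniq_not_coverable ut); first by rewrite st.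
  by move=> i it; exists i.
Qed.

Lemma Two_wins_linear_space : Two_wins_Gfin infty.
Proof.
have /choice[w wP] (Ac : set linear_space * nat) : exists F, Omega infty Ac.1 ->
    [/\ finite_set F, F `<=` Ac.1 & F infty \/
      exists m, ~ coverable (Ac.2 * m.+1) (column (Some @^-1` F) m)].
  have [/(finite_witness Ac.2)[F FP]|nO] := pselect (Omega infty Ac.1).
    by exists F.
  by exists set0.
(* In inning [n] the history has length [n.+1], which is the constant to be refuted; its last entry
   is One's current move. *)
exists (fun h => w (last set0 h, size h)) => A OA.
have rE n : reply (fun h => w (last set0 h, size h)) A n = w (A n, n.+1).
  by rewrite /reply size_mkseq /mkseq -addn1 iotaD map_cat last_cat.
have rP n := wP (A n, n.+1) (OA n).
split=> [n|]; first by rewrite rE; have [] := rP n.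
apply/Omega_inftyE.
have [?|nN] := pselect ((\bigcup_n w (A n, n.+1)) infty).
  by left; under eq_bigcupr do rewrite rE.
(* The answer of inning [c] already breaks the bound with constant [c.+1], hence the one with
   [c]. *)
right=> -[c cU]; have [_ _ [rN|[m]]] := rP c; first by apply: nN; exists c.
apply; apply: coverableS (cU m); first by rewrite leq_mul2r leqnSn orbT.
by move=> i ri; exists c; rewrite ?rE.
Qed.

Lemma not_S_f_linear_space (f : nat -> nat) :
  (forall n, 0 < f n) -> ~ S_f infty f.
Proof.
move=> f_gt0 Sf; pose g k := \sum_(n < k) f n.
have le_g k : k <= g k.
  elim: k => // k IHk; rewrite /g big_ord_recr /= -addn1.
  exact: leq_add.
(* The threshold [g n.+1] includes [f n], so the innings that can reach column [m] have total
   allowance at most [m]. *)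
pose A n : set linear_space := [set Some p | p in [set p | g n.+1 <= p.1]].
have [n|F [FA Ff /Omega_inftyE[[n _ /FA[]//]|]]] := Sf A.
  (* Column [g n.+1] of [A n] is all of [nat], so it exceeds any bound. *)
  apply/Omega_inftyE; right=> -[c /(_ (g n.+1))].
  apply: (@uniq_not_coverable _ _ _ (iota 0 (c * (g n.+1).+1).+1)).
  - exact: iota_uniq.
  - by rewrite size_iota.
  - by move=> i _; exists (g n.+1, i) => /=.
apply; exists 1 => m; rewrite mul1n.
have Fcov n : coverable (f n) (column (Some @^-1` F n) m).
  (* The column lies in the image of [F n] under the second coordinate; the default 0 at [infty] is
     harmless. *)
  have /card_le_coverable/(coverable_image (fun y => odflt 0 (omap snd y))) := Ff n.
  by apply: coverableS => // i Fi; exists (Some (m, i)).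
have gm n i : F n (Some (m, i)) -> g n.+1 <= m.
  by move=> /FA[p gp [pE]]; rewrite pE in gp.
(* The count grows like [g k] until [g k.+1] passes [m]; from then on no inning reaches column
   [m]. *)
have cov k : coverable (minn m (g k))
    (column (Some @^-1` (\bigcup_(n in `I_k) F n)) m).
  elim: k => [|k IHk].
    by apply: coverableS (coverable0 _ 0) => // i [].
  have gk : g k.+1 = g k + f k by rewrite /g big_ord_recr.
  have [km|mk] := leqP (g k.+1) m.
    rewrite gk in km; apply: coverableS (coverableU IHk (Fcov k)).
      by rewrite gk leq_add2r geq_minr.
    move=> i [n /=]; rewrite ltnS leq_eqVlt => /predU1P[->|nk] Fi.
      by right.
    by left; exists n.
  apply: coverableS IHk; first exact: geq_minl.
  move=> i [n /=]; rewrite ltnS leq_eqVlt => /predU1P[->|nk] Fi.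
    by move: (gm _ _ Fi); rewrite leqNgt mk.
  by exists n.
(* The first [m] innings suffice: one reaching column [m] has [n < g n.+1 <= m], as [f] is
   positive. *)
apply: coverableS (cov m); first by rewrite (leq_trans (geq_minl _ _)).
by move=> i [n _ Fi]; exists n => //=; apply: leq_trans (le_g _) (gm _ _ Fi).
Qed.

Theorem mainTheorem4 :
  exists (X : topologicalType) (x : X),
    [/\ accessible_space X,
        Two_wins_Gfin x &
        forall f : nat -> nat, (forall n, 0 < f n) -> unbounded f ->
          ~ S_f x f].
Proof.
exists linear_space, infty; split.
- exact: accessible_linear_space.
- exact: Two_wins_linear_space.
- by move=> f f_gt0 _; apply: not_S_f_linear_space.
Qed.
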